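(* Fix positive integers $m \ge 2$ and $\ell \ge 2m$, let $\mathbf{r}=(m\ell,\, m\ell+m,\, m\ell+2m)$, and let $S$ be the generic semigroup adapted to $\mathbf{r}$. If $\ell$ is even, let $$S^* = \left\langle m\ell,\ m\ell+m,\ m\ell+2m,\ 2m(\ell+1)+1,\ m\left(\tfrac{\ell}{2}+1\right)\ell+1 \right\rangle,$$ while if $\ell$ is odd, let $$S^* = \left\langle m\ell,\ m\ell+m,\ m\ell+2m,\ 2m(\ell+1)+1,\ \tfrac{m}{2}(\ell+1)(\ell+2)+1,\ \tfrac{m}{2}\ell(\ell+3)+1 \right\rangle.$$ Then: (1) $S^* \subseteq S$. (2) Whenever $\ell$ is even, $g(S) \le \frac14 m\ell^2 + m(m-1)\ell + (m-1)(m-2)$. (3) Whenever $\ell$ is odd, $g(S) \le \frac14 m(\ell+1)(\ell-1) + m(m-1)\ell + (m-1)(m-2)$.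
   Context: $\mathbb{N}=\{0,1,2,\dots\}$, and $\langle n_1,\dots,n_s\rangle$ denotes the set of all $\mathbb{N}$-linear combinations of $n_1,\dots,n_s$. The genus $g(S)$ of a numerical semigroup $S$ is the cardinality of $\mathbb{N}\setminus S$. $v_t$ is the $t$-adic valuation (order of vanishing at $t=0$) on $\mathbb{C}[[t]]$. Generic semigroup adapted to $\mathbf{r}=(r_1,r_2,r_3)$ with $0<r_1<r_2<r_3$: let $f_i(t)=\sum_{n\ge r_i} a_{i,n}t^n\in\mathbb{C}[[t]]$ $(i=1,2,3)$ be power series with fixed nonzero lowest-order coefficients $a_{i,r_i}$ (so $v_t(f_i)=r_i$) and generic higher-order coefficients, i.e. the coefficients $a_{i,n}$ with $n>r_i$, $i=1,2,3$, are algebraically independent over $\mathbb{Q}(a_{1,r_1},a_{2,r_2},a_{3,r_3})$. The generic semigroup adapted to $\mathbf{r}$ is the set of valuations realized by the algebra $\mathbb{C}[f_1,f_2,f_3]$, i.e. $\{v_t(G(f_1,f_2,f_3)) : G\in\mathbb{C}[x_1,x_2,x_3],\ G(f_1,f_2,f_3)\ne 0\}$. *)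

(* Defs.v *)
From HB Require Import structures.
From mathcomp Require Import all_boot all_order all_algebra.
From mathcomp Require Import finmap complex mpoly.
From mathcomp Require Import boolp classical_sets functions cardinality reals.

Set Implicit Arguments.
Unset Strict Implicit.
Unset Printing Implicit Defensive.

Import Order.TTheory GRing.Theory Num.Theory.
Local Open Scope ring_scope.

(* Formal power series in one variable t, with the Cauchy product. *)
Record fps (F : Type) := Fps { fps_coef : nat -> F }.

Lemma fpsP (F : Type) (f g : fps F) : fps_coef f =1 fps_coef g -> f = g.
Proof. by case: f => f; case: g => g /= /funext ->. Qed.

HB.instance Definition _ (F : Type) := gen_eqMixin (fps F).
HB.instance Definition _ (F : Type) := gen_choiceMixin (fps F).

Section FpsZmodule.
Variable F : zmodType.
Implicit Types f g h : fps F.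

Definition fps_zero : fps F := Fps (fun=> 0).
Definition fps_opp f := Fps (fun n => - fps_coef f n).
Definition fps_add f g := Fps (fun n => fps_coef f n + fps_coef g n).

Lemma fps_addA : associative fps_add.
Proof. by move=> f g h; apply: fpsP => n /=; rewrite addrA. Qed.
Lemma fps_addC : commutative fps_add.
Proof. by move=> f g; apply: fpsP => n /=; rewrite addrC. Qed.
Lemma fps_add0 : left_id fps_zero fps_add.
Proof. by move=> f; apply: fpsP => n /=; rewrite add0r. Qed.
Lemma fps_addN : left_inverse fps_zero fps_opp fps_add.
Proof. by move=> f; apply: fpsP => n /=; rewrite addNr. Qed.

HB.instance Definition _ :=
  GRing.isZmodule.Build (fps F) fps_addA fps_addC fps_add0 fps_addN.

End FpsZmodule.

Section FpsRing.
Variable F : comNzRingType.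
Implicit Types f g h : fps F.

Definition fps_const (c : F) : fps F := Fps (fun n => if n == 0%N then c else 0).
Definition fps_mul f g :=
  Fps (fun n => \sum_(i < n.+1) fps_coef f i * fps_coef g (n - i)).

Let trunc N f : {poly F} := \poly_(i < N) fps_coef f i.

Let mul_trunc N f g n : (n < N)%N ->
  fps_coef (fps_mul f g) n = (trunc N f * trunc N g)`_n.
Proof.
move=> ltnN; rewrite coefM; apply: eq_bigr => i _.
rewrite !coef_poly (leq_ltn_trans (leq_subr _ _) ltnN).
by rewrite (leq_ltn_trans _ ltnN) // -ltnS.
Qed.

Let coefM_eq (p q p' q' : {poly F}) n :
  (forall i, (i <= n)%N -> p`_i = p'`_i) ->
  (forall i, (i <= n)%N -> q`_i = q'`_i) -> (p * q)`_n = (p' * q')`_n.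
Proof.
move=> pp qq; rewrite !coefM; apply: eq_bigr => i _.
by rewrite pp ?qq ?leq_subr // -ltnS.
Qed.

Lemma fps_mulC : commutative fps_mul.
Proof.
by move=> f g; apply: fpsP => n; rewrite !(@mul_trunc n.+1) // mulrC.
Qed.

Lemma fps_mulA : associative fps_mul.
Proof.
move=> f g h; apply: fpsP => n; rewrite !(@mul_trunc n.+1) //.
transitivity (trunc n.+1 f * (trunc n.+1 g * trunc n.+1 h))`_n.
  by apply: coefM_eq => // i lein; rewrite coef_poly ltnS lein (@mul_trunc n.+1).
rewrite mulrA; apply: coefM_eq => // i lein.
by rewrite [RHS]coef_poly ltnS lein (@mul_trunc n.+1).
Qed.

Lemma fps_mul1 : left_id (fps_const 1) fps_mul.
Proof.
move=> f; apply: fpsP => n /=; rewrite big_ord_recl /= mul1r subn0.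
by rewrite big1 ?addr0 // => i _; rewrite mul0r.
Qed.

Lemma fps_mulDl : left_distributive fps_mul (@fps_add F).
Proof.
move=> f g h; apply: fpsP => n /=; rewrite -big_split.
by apply: eq_bigr => i _; rewrite mulrDl.
Qed.

Lemma fps_1neq0 : fps_const 1 != 0.
Proof.
apply/eqP => /(congr1 (fun f => fps_coef f 0%N)) /= /eqP.
by rewrite oner_eq0.
Qed.

HB.instance Definition _ := GRing.Zmodule_isComNzRing.Build (fps F)
  fps_mulA fps_mulC fps_mul1 fps_mulDl fps_1neq0.

Lemma fps_const_is_zmod_morphism : zmod_morphism fps_const.
Proof. by move=> a b; apply: fpsP => -[|n] //=; rewrite subr0. Qed.

Lemma fps_const_is_monoid_morphism : monoid_morphism fps_const.
Proof.
split=> // a b; apply: fpsP => n /=; rewrite big_ord_recl /= subn0.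
rewrite big1 ?addr0 => [|i _]; last by rewrite mul0r.
by case: n => [|n] //=; rewrite mulr0.
Qed.

HB.instance Definition _ := GRing.isZmodMorphism.Build F (fps F) fps_const
  fps_const_is_zmod_morphism.
HB.instance Definition _ := GRing.isMonoidMorphism.Build F (fps F) fps_const
  fps_const_is_monoid_morphism.

End FpsRing.

Local Open Scope classical_set_scope.

(* The t-adic valuation; its value at 0 is junk. *)
Definition fps_val (F : zmodType) (f : fps F) : nat :=
  xget 0%N [set n | fps_coef f n != 0 /\
                    forall k, (k < n)%N -> fps_coef f k = 0].

(* The field Q(a_i : i in I), as the smallest subfield of F containing the a_i;
   F has characteristic 0 in all uses. *)
Definition gen_subfield (F : fieldType) (I : Type) (a : I -> F) : {pred F} :=
  fun z => `[< forall K : {pred F},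
    divring_closed K -> (forall i, a i \in K) -> z \in K >].

Definition alg_independent (F : fieldType) (K : {pred F}) (I : Type)
    (x : I -> F) : Prop :=
  forall (n : nat) (s : 'I_n -> I), injective s ->
  forall P : {mpoly F[n]}, P \is a mpolyOver n K ->
  P.@[fun j => x (s j)] = 0 -> P = 0.

Definition generic_series (F : fieldType) (r : 3.-tuple nat)
    (f : 'I_3 -> fps F) : Prop :=
  [/\ forall i n, (n < tnth r i)%N -> fps_coef (f i) n = 0,
      forall i, fps_coef (f i) (tnth r i) != 0
    & alg_independent
        (gen_subfield (fun i => fps_coef (f i) (tnth r i)))
        (fun p : {p : 'I_3 * nat | (tnth r p.1 < p.2)%N} =>
           fps_coef (f (val p).1) (val p).2)].

Definition eval_fps (F : fieldType) (f : 'I_3 -> fps F)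
    (G : {mpoly F[3]}) : fps F := mmap (@fps_const F) f G.

Definition value_semigroup (F : fieldType) (f : 'I_3 -> fps F) : set nat :=
  [set n | exists G : {mpoly F[3]},
     eval_fps f G != 0 /\ fps_val (eval_fps f G) = n].

Definition is_generic_semigroup (F : fieldType) (r : 3.-tuple nat)
    (S : set nat) : Prop :=
  exists f : 'I_3 -> fps F, generic_series r f /\ S = value_semigroup f.

Definition nat_span (s : seq nat) : set nat :=
  [set n | exists c : nat -> nat, n = (\sum_(i < size s) c i * nth 0 s i)%N].

(* Only meaningful when the complement of S is finite. *)
Definition genus (S : set nat) : nat := #|` fset_set (~` S)|.

Definition rvec (m l : nat) : 3.-tuple nat :=
  [tuple (m * l)%N; (m * l + m)%N; (m * l + 2 * m)%N].

(* All the halvings are exact: l is even in the second list, and l + 1 and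
   l + 3 are even in the first one. *)
Definition Sstar (m l : nat) : set nat :=
  if odd l then
    nat_span [:: m * l; m * l + m; m * l + 2 * m; 2 * m * (l + 1) + 1;
                 (m * (l + 1) * (l + 2))./2 + 1; (m * l * (l + 3))./2 + 1]%N
  else
    nat_span [:: m * l; m * l + m; m * l + 2 * m; 2 * m * (l + 1) + 1;
                 m * (l./2 + 1) * l + 1]%N.

(* Main.v *)
Require Import Defs.
From mathcomp Require Import all_boot all_order all_algebra.
From mathcomp Require Import finmap complex mpoly.
From mathcomp Require Import boolp classical_sets functions cardinality reals.
From mathcomp Require Import zify ring lra.

(** The semigroup [S] contains the three orders [r_i] and, by one cancellation
    principle, the further generators of [S*].  If two different monomials
    [x^u], [x^v] have the same weight [N], that is
    [N = sum_i u_i r_i = sum_i v_i r_i], then scaling them to have equal leading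
    coefficients makes the terms of order [N] of [f^u] and [f^v] cancel, and the
    coefficient at [t^(N+1)] of the difference is, up to a nonzero factor,
    [sum_i (u_i - v_i) a'_i / a_i], where [a_i], [a'_i] are the first two
    coefficients of [f_i].  This is a nonzero linear form over [Q(a_1, a_2, a_3)]
    in the algebraically independent [a'_i], so it does not vanish and [N + 1]
    lies in [S] ([generic_cancellation]).  The pairs of monomials used are
    - [x_2^2] and [x_1 x_3], giving [2m(l+1) + 1];
    - for even [l], [x_1^(l/2+1)] and [x_3^(l/2)];
    - for odd [l], [x_3^((l+1)/2)] and [x_1^((l+1)/2) x_2], and also
      [x_1^((l+3)/2)] and [x_2 x_3^((l-1)/2)].

    For the genus, split the complement of [S] by residues [j] modulo [m].  Let
    [T = <l, l+1, l+2>].  Since [kl, ..., kl + 2k] all lie in [T], its gaps are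
    the [kl + r] with [2k < r < l], of which there are [floor (l^2 / 4)]
    ([size_gaps]).  In the class of [0] the complement of [S] is contained in
    [m] times the gaps of [T].  With [x = m w + 1], [w = 2(l+1)], the class of
    [j] contains [j x + m T], hence a missing [m u + j] has [u < j w] or
    [u - j w] a gap of [T].  The two remaining generators for odd [l], or
    the remaining generator [y] and [y + m(l+1)] for even [l], have the form
    [x + m g] with [g] a gap of [T]; adding [(j-1) x] to them fills two gaps in
    each of the classes [1, ..., m-1].  In total
    [g(S) <= m floor (l^2/4) + (l+1) m (m-1) - 2 (m-1)] ([genus_bound]),
    which is the stated bound for both parities. *)

Import Order.TTheory GRing.Theory Num.Theory.
Local Open Scope ring_scope.
Local Open Scope classical_set_scope.

(** * Additive submonoids of the naturals *)

Definition additive_submonoid (A : set nat) : Prop :=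
  A 0%N /\ forall a b, A a -> A b -> A (a + b)%N.

Lemma submonoid_mul {A : set nat} (a k : nat) :
  additive_submonoid A -> A a -> A (k * a)%N.
Proof.
by move=> [A0 AD] Aa; elim: k => [|k IH] //; rewrite mulSn; apply: AD.
Qed.

Lemma nat_span_sub {A : set nat} (s : seq nat) :
  additive_submonoid A -> (forall n, n \in s -> A n) -> nat_span s `<=` A.
Proof.
move=> AM As n [c ->]; have [A0 AD] := AM.
apply: (big_ind (fun n => A n)) => // i _.
by apply: submonoid_mul => //; apply: As; rewrite mem_nth.
Qed.

(** * Orders and two-term expansions of power series *)

Definition has_order {F : zmodType} (f : fps F) (n : nat) : Prop :=
  fps_coef f n != 0 /\ forall k, (k < n)%N -> fps_coef f k = 0.

Lemma has_order_val {F : zmodType} {f : fps F} {n : nat} :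
  has_order f n -> fps_val f = n.
Proof.
move=> [nz lt_n]; rewrite /fps_val; case: xgetP => [p _ [pnz lt_p]|/(_ n)[]//].
case: (ltngtP p n) => // [/lt_n/eqP | /lt_p/eqP] zero.
  by rewrite zero in pnz.
by rewrite zero in nz.
Qed.

Lemma has_order_neq0 {F : zmodType} {f : fps F} {n : nat} : has_order f n -> f != 0.
Proof. by case=> nz _; apply: contra_neq nz => ->. Qed.

Lemma has_order_exists {F : zmodType} {f : fps F} :
  f != 0 -> exists n, has_order f n.
Proof.
move=> nz; have nzc : exists n, fps_coef f n != 0.
  apply: contrapT => /forallNP f0; case/eqP: nz; apply: fpsP => n /=.
  by have /negP := f0 n; rewrite negbK => /eqP.
case: (ex_minnP nzc) => n nzn n_min; exists n; split=> // k.
by rewrite ltnNge; apply: contraNeq => /n_min.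
Qed.

Section JetsOfSeries.
Context {F : comNzRingType}.
Implicit Types f g : fps F.

(** The next coefficient is recorded as [a * s], so that [s] plays the role of
    a logarithmic derivative: along products the orders and the [s] add while
    the leading coefficients multiply. *)
Definition two_jet f (n : nat) (a s : F) : Prop :=
  [/\ forall k, (k < n)%N -> fps_coef f k = 0, fps_coef f n = a
    & fps_coef f n.+1 = a * s].

Lemma fps_mul_low {f g n p} :
    (forall k, (k < n)%N -> fps_coef f k = 0) ->
    (forall k, (k < p)%N -> fps_coef g k = 0) ->
  (forall k, (k < n + p)%N -> fps_coef (f * g) k = 0) /\
  fps_coef (f * g) (n + p) = fps_coef f n * fps_coef g p.
Proof.
move=> f0 g0; split=> [k ltk|] /=.
  rewrite big1 // => i _; have [/f0 ->|len] := ltnP i n; first by rewrite mul0r.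
  by rewrite g0 ?mulr0 //; have := ltn_ord i; lia.
have ltn : (n < (n + p).+1)%N by lia.
rewrite (bigD1 (Ordinal ltn)) //= addKn big1 ?addr0 // => i neq.
have {}neq : i != n :> nat by [].
have [/f0 ->|len] := ltnP i n; first by rewrite mul0r.
by rewrite g0 ?mulr0 //; have := ltn_ord i; lia.
Qed.

Lemma two_jetM {f g n p a b s t} :
  two_jet f n a s -> two_jet g p b t -> two_jet (f * g) (n + p) (a * b) (s + t).
Proof.
move=> [f0 fn fn1] [g0 gp gp1]; have [lo mid] := fps_mul_low f0 g0.
split=> //; first by rewrite mid fn gp.
have lt0 : (n < (n + p).+2)%N by lia.
have lt1 : (n.+1 < (n + p).+2)%N by lia.
rewrite /= (bigD1 (Ordinal lt0)) //= (bigD1 (Ordinal lt1)) //=; last first.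
  by rewrite -val_eqE /=; lia.
rewrite big1 ?addr0 => [|i /andP[neq0 neq1]].
  have -> : ((n + p).+1 - n)%N = p.+1 by lia.
  have -> : ((n + p).+1 - n.+1)%N = p by lia.
  by rewrite fn gp fn1 gp1; ring.
have {}neq0 : i != n :> nat by [].
have {}neq1 : i != n.+1 :> nat by [].
have [/f0 ->|len] := ltnP i n; first by rewrite mul0r.
by rewrite g0 ?mulr0 //; have := ltn_ord i; lia.
Qed.

Lemma two_jet1 : two_jet 1 0 1 0.
Proof. by split=> //=; rewrite mulr0. Qed.

Lemma two_jetX {f n a s} k :
  two_jet f n a s -> two_jet (f ^+ k) (n * k) (a ^+ k) (s *+ k).
Proof.
move=> jf; elim: k => [|k IH]; first by rewrite muln0; apply: two_jet1.
by rewrite mulnS !exprS mulrS; apply: two_jetM.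
Qed.

Lemma two_jet_prod {I : finType} {f : I -> fps F} {n : I -> nat} {a s : I -> F} :
    (forall i, two_jet (f i) (n i) (a i) (s i)) ->
  two_jet (\prod_i f i) (\sum_i n i) (\prod_i a i) (\sum_i s i).
Proof.
move=> jf; elim: (index_enum I) => [|i r IH].
  by rewrite !big_nil; apply: two_jet1.
by rewrite !big_cons; apply: two_jetM.
Qed.

Lemma fps_coef_constM (c : F) f n :
  fps_coef (fps_const c * f) n = c * fps_coef f n.
Proof.
rewrite /= big_ord_recl /= subn0 big1 ?addr0 // => i _.
by rewrite mul0r.
Qed.

(** With equal orders the leading terms of [b f] and [a g] agree, so the order
    of the difference is read off from the difference of the two [s]. *)
Lemma two_jet_cancel {f g n a b s t} :
    two_jet f n a s -> two_jet g n b t -> a * b * (s - t) != 0 ->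
  has_order (fps_const b * f - fps_const a * g) n.+1.
Proof.
move=> [f0 fn fn1] [g0 gn gn1] nz.
have E k : fps_coef (fps_const b * f - fps_const a * g) k
    = b * fps_coef f k - a * fps_coef g k.
  by rewrite -!fps_coef_constM.
split=> [|k]; rewrite E; first by rewrite fn1 gn1 -[X in X != 0](_ : a * b * (s - t) = _) //; ring.
rewrite ltnS leq_eqVlt => /orP[/eqP ->|ltk]; first by rewrite fn gn; ring.
by rewrite f0 // g0 // !mulr0 subr0.
Qed.

End JetsOfSeries.

Lemma has_orderM {F : idomainType} {f g : fps F} {n p : nat} :
  has_order f n -> has_order g p -> has_order (f * g) (n + p).
Proof.
move=> [fn f0] [gp g0]; have [lo mid] := fps_mul_low f0 g0.
by split=> //; rewrite mid mulf_neq0.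
Qed.

Section ValueSemigroup.
Variables (F : fieldType) (f : 'I_3 -> fps F).

Lemma value_semigroupP (n : nat) :
  (exists G, has_order (eval_fps f G) n) -> value_semigroup f n.
Proof.
move=> [G oG]; exists G; split; first exact: has_order_neq0 oG.
exact: has_order_val.
Qed.

Lemma value_semigroup_submonoid : additive_submonoid (value_semigroup f).
Proof.
split=> [|a b [G [nzG <-]] [H [nzH <-]]]; apply: value_semigroupP.
  exists 1; rewrite /eval_fps rmorph1; split=> //=; exact: oner_neq0.
exists (G * H); rewrite /eval_fps rmorphM /= -/(eval_fps f G) -/(eval_fps f H).
have [p op] := has_order_exists nzG; have [q oq] := has_order_exists nzH.
by rewrite (has_order_val op) (has_order_val oq); apply: has_orderM.
Qed.

End ValueSemigroup.

Section GenericSeries.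
Variables (F : fieldType) (r : 3.-tuple nat) (f : 'I_3 -> fps F).
Hypothesis char0 : [pchar F] =i pred0.
Hypothesis gen_f : generic_series r f.

Let lead i := fps_coef (f i) (tnth r i).
Let next i := fps_coef (f i) (tnth r i).+1.

Lemma generic_two_jet i : two_jet (f i) (tnth r i) (lead i) (next i / lead i).
Proof.
have [low nz _] := gen_f; split=> //; first exact: low.
by rewrite mulrC divfK //; apply: nz.
Qed.

Lemma generic_order i : value_semigroup f (tnth r i).
Proof.
have [low nz _] := gen_f; apply: value_semigroupP.
exists 'X_i; rewrite /eval_fps mmapX mmap1U.
by split; [apply: nz | apply: low].
Qed.

Lemma gen_subfield_divring (I : Type) (a : I -> F) :
  divring_closed (gen_subfield a).
Proof.
split=> [|x y /asboolP xK /asboolP yK|x y /asboolP xK /asboolP yK];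
  apply/asboolP => K K_closed aK; have [K1 KB Kd] := K_closed => //.
- by apply: KB; [apply: xK | apply: yK].
- by apply: Kd; [apply: xK | apply: yK].
Qed.

Lemma gen_subfield_gen (I : Type) (a : I -> F) i : a i \in gen_subfield a.
Proof. by apply/asboolP => K _; apply. Qed.

(** The second coefficients [next i] are among the coefficients assumed to be
    algebraically independent, so they satisfy no linear relation: the relation
    is a polynomial of degree one evaluated at them. *)
Lemma generic_next_free (c : 'I_3 -> F) :
    (forall i, c i \in gen_subfield lead) -> \sum_i c i * next i = 0 ->
  forall i, c i = 0.
Proof.
move=> cK sum0.
have [K1 KB _] := gen_subfield_divring _ lead.
have K0 : 0 \in gen_subfield lead by rewrite -(subrr 1) KB.
have P0 : \sum_i c i *: 'X_i = 0 :> {mpoly F[3]}.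
  have [_ _ alg] := gen_f.
  apply: (alg 3 (fun i => exist _ (i, (tnth r i).+1) (ltnSn _))) => [i j []//||].
    rewrite qualifE /=; apply/allP => _ /mapP[mn _ ->]; rewrite raddf_sum /=.
    apply: (big_ind (fun x => x \in gen_subfield lead)) => // [x y xK yK|i _].
      by rewrite -[y]opprK KB // -[- y]sub0r KB.
    by rewrite mcoeffZ mcoeffX; case: eqP; rewrite ?mulr1 ?mulr0.
  rewrite raddf_sum -[RHS]sum0; apply: eq_bigr => i _ /=.
  by rewrite mevalZ mevalXU.
move=> i; have /(congr1 (mcoeff U_(i))) := P0.
rewrite raddf_sum mcoeff0 (bigD1 i) //= big1 ?addr0 => [|j neq_ji].
  by rewrite mcoeffZ mcoeffXU eqxx mulr1.
by rewrite mcoeffZ mcoeffXU (negbTE neq_ji) mulr0.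
Qed.

Let natr_inj : injective (fun k : nat => k%:R : F).
Proof.
move=> p q; wlog le_pq : p q / (p <= q)%N => [wl|] pq.
  by case/orP: (leq_total p q) => le; [apply: wl | rewrite (wl q p)].
apply/eqP; rewrite eqn_leq le_pq -subn_eq0 -((pcharf0P F).1 char0) natrB //.
by rewrite (pq : p%:R = q%:R) subrr eqxx.
Qed.

(** Eliminate the common leading term of two monomials of weight [n].  The
    coefficient that follows is proportional to
    [sum_j (u_j - v_j) / lead j * next j], a linear form over the field of the
    leading coefficients; in characteristic zero it is not identically zero
    because [u] and [v] differ. *)
Lemma generic_cancellation (u v : 'X_{1..3}) (i : 'I_3) (n : nat) :
    u i != v i ->
    (\sum_i tnth r i * u i)%N = n -> (\sum_i tnth r i * v i)%N = n ->
  value_semigroup f n.+1.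
Proof.
move=> neq_uv wu wv; have [_ nz _] := gen_f.
pose c (w : 'X_{1..3}) := \prod_i lead i ^+ w i.
have nzc w : c w != 0 by apply/prodf_neq0 => j _; rewrite expf_neq0 // nz.
have jet (w : 'X_{1..3}) := two_jet_prod (fun j => two_jetX (w j) (generic_two_jet j)).
have ju := jet u; have jv := jet v; rewrite wu in ju; rewrite wv in jv.
apply: value_semigroupP; exists (c v *: 'X_[u] - c u *: 'X_[v]).
rewrite /eval_fps raddfB /= !mmapZ !mmapX.
apply: two_jet_cancel ju jv _; rewrite !mulf_neq0 ?nzc //.
apply: contra_neq neq_uv => sum0.
pose d j : F := ((u j)%:R - (v j)%:R) / lead j.
suff /(_ i)/eqP : forall j, d j = 0.
  rewrite mulf_eq0 invr_eq0 (negbTE (nz i)) orbF subr_eq0.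
  by rewrite (inj_eq natr_inj) => /eqP.
apply: generic_next_free => [j|].
  have [K1 KB Kd] := gen_subfield_divring _ lead.
  have K0 : 0 \in gen_subfield lead by rewrite -(subrr 1) KB.
  have KN1 : -1 \in gen_subfield lead by rewrite -sub0r KB.
  have Knat k : k%:R \in gen_subfield lead.
    elim: k => [|k IH]; first exact: K0.
    have -> : k.+1%:R = k%:R - -1 :> F by rewrite opprK natr1.
    exact: KB.
  by apply: Kd; [apply: KB | apply: gen_subfield_gen].
rewrite -[RHS]sum0 -sumrB; apply: eq_bigr => j _.
rewrite -[in RHS]mulr_natl -[in X in _ = _ - X]mulr_natl -mulrBl /d -mulrA.
by rewrite [X in _ = _ * X]mulrC.
Qed.
End GenericSeries.

(** * Counting the gaps *)

(** The gaps of the semigroup generated by [l], [l + 1] and [l + 2]: the sums of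
    [k] generators fill the interval from [k * l] to [k * l + 2 * k], so what is
    missing are the [k * l + r] with [2 * k < r < l]. *)
Definition gaps (l : nat) : seq nat :=
  [seq k * l + r | r <- iota 0 l, k <- iota 0 (uphalf r)]%N.

Lemma mem_gaps {l k r : nat} : (2 * k < r < l)%N -> (k * l + r)%N \in gaps l.
Proof.
move=> lt; apply/allpairsPdep; exists r, k; rewrite !mem_iota.
by split=> //; lia.
Qed.

Lemma size_gaps (l : nat) : (4 * size (gaps l) + odd l = l ^ 2)%N.
Proof.
rewrite size_allpairs_dep.
under eq_map do rewrite size_iota.
elim: l => // l IH; rewrite -[in iota _ _]addn1 iotaD map_cat sumn_cat /=; lia.
Qed.

Section Counting.
Variables (A : set nat) (m l : nat).
Hypotheses (A_monoid : additive_submonoid A) (m_gt0 : (0 < m)%N) (l_gt0 : (0 < l)%N).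
Hypotheses (A_gen1 : A (m * l)%N) (A_gen2 : A (m * l + m)%N)
  (A_gen3 : A (m * l + 2 * m)%N).

(** Going up one row: [r] is lowered by at most [2] on removing one of the three
    generators. *)
Lemma submonoid_block (k r : nat) :
  (r <= 2 * k)%N -> A (m * (k * l + r))%N.
Proof.
have [_ AD] := A_monoid.
elim: k r => [|k IH] r le_r.
  have -> : r = 0%N by lia.
  by rewrite muln0; have [] := A_monoid.
have [->|r_gt0] := posnP r.
  have -> : (m * (k.+1 * l + 0) = k.+1 * (m * l))%N by ring.
  exact: submonoid_mul.
have [r1|r_gt1] := eqVneq r 1%N.
  have -> : (m * (k.+1 * l + r) = (m * l + m) + m * (k * l + 0))%N.
    by rewrite r1; ring.
  by apply: AD => //; apply: IH.
have -> : (m * (k.+1 * l + r) = (m * l + 2 * m) + m * (k * l + (r - 2)))%N.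
  by rewrite -{1}(subnK (_ : 2 <= r)%N); [ring | lia].
by apply: AD => //; apply: IH; lia.
Qed.

Lemma submonoid_gaps (u : nat) : u \notin gaps l -> A (m * u)%N.
Proof.
move=> u_gap; rewrite (divn_eq u l); apply: submonoid_block.
rewrite leqNgt; apply: contra u_gap => lt.
by rewrite {1}(divn_eq u l) mem_gaps // lt ltn_mod.
Qed.

Variables (w g1 g2 : nat).
Hypotheses (A_w : A (m * w + 1)%N) (A_g1 : A (m * w + 1 + m * g1)%N)
  (A_g2 : A (m * w + 1 + m * g2)%N).
Hypotheses (gap1 : g1 \in gaps l) (gap2 : g2 \in gaps l) (neq_g : g1 != g2).

Let gaps' := rem g2 (rem g1 (gaps l)).

(** The numbers not yet seen to lie in [A], by residue class modulo [m]: in the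
    class of [0], the gaps of [<l, l+1, l+2>] scaled by [m]; in the class of [j],
    what lies below [j * w] and the same gaps shifted by [j * w], except for
    [g1] and [g2]. *)
Definition gap_candidates : seq nat :=
  ([seq m * u | u <- gaps l] ++
   [seq m * u + j | j <- iota 1 m.-1,
      u <- iota 0 (j * w) ++ [seq j * w + u | u <- gaps']])%N.

(** In the class of [j > 0], [j] copies of [m * w + 1] reach everything above
    [j * w] except the gaps of [<l, l+1, l+2>]; trading one copy for
    [m * w + 1 + m * g1] or [m * w + 1 + m * g2] reaches two of these. *)
Lemma compl_gap_candidates : ~` A `<=` [set` gap_candidates].
Proof.
have [_ AD] := A_monoid.
move=> n nA; rewrite /= mem_cat; apply/orP.
have [j0|j_gt0] := posnP (n %% m).
  left; have n_eq : n = (m * (n %/ m))%N by rewrite {1}(divn_eq n m) j0 addn0 mulnC.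
  rewrite n_eq map_f //; apply: contrapT => /negP /submonoid_gaps.
  by rewrite -n_eq.
right; apply/allpairsPdep; exists (n %% m)%N, (n %/ m)%N.
have j_lt := ltn_pmod n m_gt0; move: (divn_eq n m) j_gt0 j_lt nA.
move: (n %/ m)%N (n %% m)%N => u j -> {n} j_gt0 j_lt nA.
split; [by rewrite mem_iota; lia| |by rewrite mulnC].
rewrite mem_cat mem_iota add0n /=; apply/orP.
have [|le_u] := ltnP u (j * w); [by left | right].
rewrite -(subnKC le_u) map_f //; set v := (u - j * w)%N.
have n_eq : (u * m + j = j * (m * w + 1) + m * v)%N.
  by rewrite -{1}(subnKC le_u) -/v; ring.
have Aj := submonoid_mul _ j A_monoid A_w.
have Aj1 := submonoid_mul _ j.-1 A_monoid A_w.
have n_eq' : (u * m + j = j.-1 * (m * w + 1) + (m * w + 1 + m * v))%N.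
  by rewrite n_eq -{1}(prednK j_gt0); ring.
apply: rem_mem; last apply: rem_mem.
- by apply: contra_notN nA => /eqP v2; rewrite n_eq' v2; apply: AD.
- by apply: contra_notN nA => /eqP v1; rewrite n_eq' v1; apply: AD.
apply: contrapT => /negP /submonoid_gaps Av; apply: nA.
by rewrite n_eq; apply: AD.
Qed.

Lemma size_gap_candidates :
  (size gap_candidates + 2 * m.-1
   = m * size (gaps l) + w * 'C(m, 2))%N.
Proof.
have sz : (size gaps' + 2 = size (gaps l))%N.
  have g2_rem : g2 \in rem g1 (gaps l) by rewrite rem_mem // eq_sym.
  have : (0 < size (rem g1 (gaps l)))%N by case: (rem _ _) g2_rem.
  have -> : size gaps' = (size (gaps l)).-2 by rewrite (size_rem g2_rem) (size_rem gap1).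
  by rewrite (size_rem gap1); case: (size _) => [|[|s]] // _; rewrite addn2.
rewrite size_cat size_map size_allpairs_dep -sz.
under eq_map do rewrite size_cat size_iota size_map.
have -> N : (sumn [seq j * w + size gaps' | j <- iota 1 N] = w * 'C(N.+1, 2) + N * size gaps')%N.
  elim: N => [|N IH]; first by rewrite muln0.
  rewrite -[X in iota _ X]addn1 iotaD map_cat sumn_cat IH /= [in RHS]binS bin1; ring.
rewrite prednK //; move: (prednK m_gt0); move: m.-1 (size gaps') => k s <-.
ring.
Qed.

Lemma genus_bound : finite_set (~` A) /\
  (genus A + 2 * m.-1 <= m * size (gaps l) + w * 'C(m, 2))%N.
Proof.
have finA : finite_set (~` A).
  exact: sub_finite_set compl_gap_candidates (finite_seq _).
split=> //; rewrite -size_gap_candidates leq_add2r /genus.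
apply: leq_trans (size_undup _); rewrite -card_fseq.
apply: fsubset_leq_card; apply/fsubsetP => n.
by rewrite in_fset_set // => /set_mem /compl_gap_candidates /=; rewrite in_fset.
Qed.
End Counting.

(** * The generic semigroup *)

Lemma rvec_cancellation {F : fieldType} {m l : nat} {f : 'I_3 -> fps F}
    (a b c a' b' c' n : nat) :
    [pchar F] =i pred0 -> generic_series (rvec m l) f ->
    (a, b, c) != (a', b', c') ->
    (m * l * a + (m * l + m) * b + (m * l + 2 * m) * c = n)%N ->
    (m * l * a' + (m * l + m) * b' + (m * l + 2 * m) * c' = n)%N ->
  value_semigroup f n.+1.
Proof.
move=> char0 gen_f neq_uv wu wv.
pose u : 'X_{1..3} := Multinom [tuple a; b; c].
pose v : 'X_{1..3} := Multinom [tuple a'; b'; c'].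
have [i neq_i] : exists i, u i != v i.
  apply: contrapT => /forallNP eq_uv; case/negP: neq_uv; apply/eqP.
  have eqi i : u i = v i by have /negP := eq_uv i; rewrite negbK => /eqP.
  have := (eqi (inord 0), eqi (inord 1), eqi (inord 2)).
  by rewrite !multinomE !(tnth_nth 0%N) !inordK //= => -[[-> ->] ->].
apply: (generic_cancellation _ _ _ char0 gen_f u v i) => //.
  rewrite -wu !big_ord_recl big_ord0 !multinomE !(tnth_nth 0%N) /=; ring.
rewrite -wv !big_ord_recl big_ord0 !multinomE !(tnth_nth 0%N) /=; ring.
Qed.

(** The identity [4 c + odd l = l ^ 2] is the exact form of
    [c = floor (l^2 / 4)], which treats both parities at once. *)
Lemma genus_bound_rat {m l g c : nat} :
    (0 < m)%N -> (4 * c + odd l = l ^ 2)%N ->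
    (g + 2 * m.-1 <= m * c + 2 * (l + 1) * 'C(m, 2))%N ->
  g%:R <= 1 / 4 * m%:R * (l%:R ^+ 2 - (odd l)%:R) + m%:R * (m%:R - 1) * l%:R
    + (m%:R - 1) * (m%:R - 2) :> rat.
Proof.
case: m => // m _ cE le_g.
have bin2E : ('C(m.+1, 2) * 2 = m.+1 * m)%N.
  by rewrite (bin_ffact m.+1 2) ffactnS ffactn1.
have {}le_g : (g + 2 * m <= m.+1 * c + (l + 1) * (m.+1 * m))%N.
  by rewrite -bin2E; apply: leq_trans le_g _; apply/eq_leq; ring.
have {}cE : 4 * c%:R = l%:R ^+ 2 - (odd l)%:R :> rat.
  by rewrite -natrX -cE natrD natrM addrK.
move: le_g; rewrite -(ler_nat rat) -cE !(natrD, natrM) -natr1; lra.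
Qed.

Theorem theorem2p10 (R : realType) (m l : nat) (S : set nat)
  (hm : (2 <= m)%N) (hl : (2 * m <= l)%N)
  (hS : is_generic_semigroup R[i] (rvec m l) S) :
  [/\ Sstar m l `<=` S,
      ~~ odd l -> finite_set (~` S) /\
        (genus S)%:R <= 1 / 4 * m%:R * l%:R ^+ 2
          + m%:R * (m%:R - 1) * l%:R + (m%:R - 1) * (m%:R - 2) :> rat
    & odd l -> finite_set (~` S) /\
        (genus S)%:R <= 1 / 4 * m%:R * (l%:R + 1) * (l%:R - 1)
          + m%:R * (m%:R - 1) * l%:R + (m%:R - 1) * (m%:R - 2) :> rat].
Proof.
have [f [gen_f ->]] := hS.
have char0 : [pchar R[i]] =i pred0 by apply: pchar_num.
have SM := value_semigroup_submonoid _ f.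
set A := value_semigroup f in SM *; have [_ AD] := SM.
have A1 : A (m * l)%N.
  by have := generic_order _ _ _ gen_f (inord 0); rewrite (tnth_nth 0%N) inordK.
have A2 : A (m * l + m)%N.
  by have := generic_order _ _ _ gen_f (inord 1); rewrite (tnth_nth 0%N) inordK.
have A3 : A (m * l + 2 * m)%N.
  by have := generic_order _ _ _ gen_f (inord 2); rewrite (tnth_nth 0%N) inordK.
have cancel a b c a' b' c' n := rvec_cancellation a b c a' b' c' n char0 gen_f.
have Ax : A (m * (2 * (l + 1)) + 1)%N.
  by rewrite addn1; apply: (cancel 0 2 0 1 0 1)%N => //; ring.
have m_gt0 : (0 < m)%N by lia.
have l_gt0 : (0 < l)%N by lia.
have bound := genus_bound A m l SM m_gt0 l_gt0 A1 A2 A3 _ _ _ Ax.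
have Gsize := size_gaps l.
have AxE : A (2 * m * (l + 1) + 1)%N by have := Ax; rewrite mulnCA mulnA.
rewrite /Sstar; case: ifP => odd_l.
  have [k l_eq] : exists k, l = (2 * k + 3)%N by exists (l./2 - 1)%N; lia.
  have y1E : ((m * (l + 1) * (l + 2))./2 = m * (k + 2) * (2 * k + 5))%N.
    have -> : (m * (l + 1) * (l + 2) = (m * (k + 2) * (2 * k + 5)).*2)%N.
      by rewrite l_eq -muln2; ring.
    exact: doubleK.
  have y2E : ((m * l * (l + 3))./2 = m * (2 * k + 3) * (k + 3))%N.
    have -> : (m * l * (l + 3) = (m * (2 * k + 3) * (k + 3)).*2)%N.
      by rewrite l_eq -muln2; ring.
    exact: doubleK.
  have Ay1 : A ((m * (l + 1) * (l + 2))./2 + 1)%N.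
    rewrite addn1 y1E; apply: (cancel 0 0 (k + 2) (k + 2) 1 0)%N.
    - by rewrite !xpair_eqE /= andbF.
    - by rewrite l_eq; ring.
    - by rewrite l_eq; ring.
  have Ay2 : A ((m * l * (l + 3))./2 + 1)%N.
    rewrite addn1 y2E; apply: (cancel (k + 3) 0 0 0 1 (k + 1))%N.
    - by rewrite !xpair_eqE /= andbF.
    - by rewrite l_eq; ring.
    - by rewrite l_eq; ring.
  split=> // [|_].
    apply: nat_span_sub => // n; rewrite !inE.
    by move=> /or4P[/eqP->|/eqP->|/eqP->|/or3P[/eqP->|/eqP->|/eqP->]].
  (* The two largest gaps of <l, l+1, l+2>, both in the row with 2 * k = l - 3. *)
  have [|||||finA le_g] := bound (k * l + (l - 2))%N (k * l + (l - 1))%N.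
  - move: Ay2; rewrite y2E; congr A; rewrite l_eq.
    have -> : (2 * k + 3 - 2 = 2 * k + 1)%N by lia.
    ring.
  - move: Ay1; rewrite y1E; congr A; rewrite l_eq.
    have -> : (2 * k + 3 - 1 = 2 * k + 2)%N by lia.
    ring.
  - by apply: mem_gaps; lia.
  - by apply: mem_gaps; lia.
  - by rewrite eqn_add2l; lia.
  split=> //; have := genus_bound_rat m_gt0 Gsize le_g; rewrite odd_l.
  by rewrite subr_sqr_1 [(l%:R - 1) * _]mulrC mulrA.
have [k l_eq] : exists k, l = (2 * k + 4)%N by exists (l./2 - 2)%N; lia.
have half_l : l./2 = (k + 2)%N by lia.
have Ay : A (m * (l./2 + 1) * l + 1)%N.
  rewrite addn1; apply: (cancel (k + 3) 0 0 0 0 (k + 2))%N.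
  - by rewrite !xpair_eqE addn3.
  - by rewrite half_l l_eq; ring.
  - by rewrite half_l l_eq; ring.
split=> // [|_].
  apply: nat_span_sub => // n; rewrite !inE.
  by move=> /or4P[/eqP->|/eqP->|/eqP->|/orP[/eqP->|/eqP->]].
(* The largest gap, in the row of k.+1 = l/2 - 1, and the middle one of the
   three gaps in the row before; they differ by l + 1. *)
have [|||||finA le_g] := bound (k * l + (l - 2))%N (k.+1 * l + (l - 1))%N.
- move: Ay; congr A; rewrite half_l l_eq.
  have -> : (2 * k + 4 - 2 = 2 * k + 2)%N by lia.
  ring.
- have := AD _ _ Ay A2; congr A; rewrite half_l l_eq.
  have -> : (2 * k + 4 - 1 = 2 * k + 3)%N by lia.
  ring.
- by apply: mem_gaps; lia.
- by apply: mem_gaps; lia.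
- by rewrite mulSn; lia.
split=> //; have := genus_bound_rat m_gt0 Gsize le_g; rewrite odd_l subr0.
by rewrite mulrA.
Qed.
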